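(* Let $\mathcal{X}=\mathbb{R}^n_+$ or $\mathcal{X}=\mathbb{R}^n$, let $A\in\mathbb{R}^{m\times n}$, $\mathbf{b}\in\mathbb{R}^m$ with $\mathbf{b}\neq\mathbf{0}$, and $\gamma>0$; assume $\{\mathbf{x}\in\mathcal{X} : A\mathbf{x}=\mathbf{b}\}\neq\emptyset$. Consider the unconstrained problem $$\min_{\mathbf{x}\in\mathcal{X}}\ \gamma\frac{\|\mathbf{x}\|_1}{\|\mathbf{x}\|_2}+\frac12\|A\mathbf{x}-\mathbf{b}\|_2^2 .$$ Let $\mathbf{x}$ be any local minimizer of this problem, let $\Lambda=\mathrm{supp}(\mathbf{x})$, $a=\|\mathbf{x}\|_1$, $r=\|\mathbf{x}\|_2$, and for $i\in\Lambda$ let $\delta_i=\mathbf{e}_i^\top(A_\Lambda^\top A_\Lambda)\mathbf{e}_i$ and $\tilde\delta_i=\delta_i/\gamma$. Define $$\Delta_i:=\frac{4}{r^6}+\frac{12a^2}{r^8}-\frac{12a\tilde\delta_i}{r^5},$$ $$\kappa_{1,i}:=\frac{\frac{2}{r^3}-\sqrt{\frac{4}{r^6}+\frac{12a^2}{r^8}-\frac{12a\tilde\delta_i}{r^5}}}{\frac{6a}{r^5}},\qquad \kappa_{2,i}:=\frac{\frac{2}{r^3}+\sqrt{\frac{4}{r^6}+\frac{12a^2}{r^8}-\frac{12a\tilde\delta_i}{r^5}}}{\frac{6a}{r^5}}.$$ Then for each $i\in\Lambda$: (i) if $\tilde\delta_i<\frac{a}{r^3}+\frac{1}{3ar}$,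 then $\Delta_i>0$; (ii) if $\frac{a}{r^3}\ge\tilde\delta_i$, then $|x_i|\ge\kappa_{2,i}$; (iii) if $\frac{a}{r^3}<\tilde\delta_i<\frac{a}{r^3}+\frac{1}{3ar}$, then $|x_i|\le\kappa_{1,i}$ or $|x_i|\ge\kappa_{2,i}$.
   Context: $\mathbb{R}^n_+$ is the set of entrywise nonnegative vectors in $\mathbb{R}^n$. $\|\cdot\|_1$ and $\|\cdot\|_2$ are the usual $1$- and $2$-norms. $\mathrm{supp}(\mathbf{x})=\{i\in\{1,\dots,n\} : x_i\ne 0\}$. $A_\Lambda$ is the submatrix of $A$ formed by the columns with index in $\Lambda$; its columns are indexed by $\Lambda$, and $\mathbf{e}_i$ is the corresponding standard unit vector, so $\delta_i$ is the diagonal entry of $A_\Lambda^\top A_\Lambda$ at index $i$, i.e. the squared $2$-norm of the $i$-th column of $A$. The ratio $\|\mathbf{x}\|_1/\|\mathbf{x}\|_2$ is considered for $\mathbf{x}\neq\mathbf{0}$, so local minimizers are nonzero vectors of $\mathcal{X}$, minimal relative to nearby nonzero points of $\mathcal{X}$. The matrix $A$ is a sensing matrix with $m\ll n$ (informal: fewer rows than columns). *)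

(* Defs.v *)
From HB Require Import structures.
From mathcomp Require Import all_boot all_order all_algebra.
From mathcomp Require Import all_classical all_reals all_analysis.
Set Implicit Arguments.
Unset Strict Implicit.
Unset Printing Implicit Defensive.
Import Order.TTheory GRing.Theory Num.Theory.
Import numFieldNormedType.Exports.
Local Open Scope classical_set_scope.
Local Open Scope ring_scope.

(* The library norm on matrices is the max norm, hence the explicit 1- and
   2-norms; the max norm is only used through the topology it induces. *)
Definition norm1 (R : realType) (n : nat) (x : 'cV[R]_n) : R :=
  \sum_(i < n) `|x i 0|.

Definition norm2 (R : realType) (n : nat) (x : 'cV[R]_n) : R :=
  Num.sqrt (\sum_(i < n) x i 0 ^+ 2).

Definition nonneg_orthant (R : realType) (n : nat) : set 'cV[R]_n :=
  [set x | forall i, 0 <= x i 0].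

Definition supp (R : realType) (n : nat) (x : 'cV[R]_n) : {set 'I_n} :=
  [set i | x i 0 != 0]%SET.

(* The k-th column of [col_submx A L] is the column of [A] of index
   [enum_val k]; the column of index [i \in L] is thus at position
   [enum_rank_in Li i], where [Li : i \in L]. *)
Definition col_submx (R : realType) (m n : nat) (A : 'M[R]_(m, n))
    (L : {set 'I_n}) : 'M[R]_(m, #|L|) :=
  colsub (@enum_val _ (mem L)) A.

Definition unit_vec (R : realType) (n : nat) (L : {set 'I_n}) (i : 'I_n)
    (Li : i \in L) : 'cV[R]_#|L| :=
  delta_mx (enum_rank_in Li i) 0.

Definition local_minimizer (R : realType) (T : topologicalType)
    (D : set T) (f : T -> R) (x : T) : Prop :=
  D x /\ \forall y \near within D (nbhs x), f x <= f y.

Definition objective (R : realType) (m n : nat) (A : 'M[R]_(m, n))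
    (b : 'cV[R]_m) (gamma : R) (x : 'cV[R]_n) : R :=
  gamma * (norm1 x / norm2 x) + 2^-1 * norm2 (A *m x - b) ^+ 2.

(* Main.v *)
(* Moving a local minimizer along its [i]-th coordinate by [t] away from [0]
   keeps it feasible for small [|t|] and turns the objective into
     gamma * (a + t) / sqrt (r^2 + 2 |x_i| t + t^2) + a quadratic in [t].
   Nonnegativity of the second derivative at [t = 0] reads
     3 a / r^5 |x_i|^2 - 2 / r^3 |x_i| - a / r^3 + delta_i / gamma >= 0,
   a quadratic inequality in [|x_i|] of discriminant [Delta_i] and roots
   [kappa1_i], [kappa2_i]; when delta_i / gamma <= a / r^3 the product of the
   roots is nonpositive, which excludes [0 < |x_i| <= kappa1_i]. *)
Require Import Defs.
From HB Require Import structures.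
From mathcomp Require Import all_boot all_order all_algebra.
From mathcomp Require Import all_classical all_reals all_analysis.
From mathcomp Require Import ring lra.
Set Implicit Arguments.
Unset Strict Implicit.
Unset Printing Implicit Defensive.
Import Order.TTheory GRing.Theory Num.Theory.
Import numFieldNormedType.Exports.
Local Open Scope classical_set_scope.
Local Open Scope ring_scope.

(** Second-order Taylor polynomial with a generous cubic remainder. Squaring reduces the bound to a
    polynomial inequality, so no derivative is taken. *)
Lemma invr_sqrt1D_le (R : rcfType) (w : R) : `|w| <= 2^-1 ->
  (Num.sqrt (1 + w))^-1 <= 1 - w / 2 + 3 / 8 * w ^+ 2 + `|w| ^+ 3.
Proof.
move=> hw; set P := (X in _ <= X).
have w_bnd : - 2^-1 <= w <= 2^-1 by rewrite -ler_norml.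
have w1_gt0 : 0 < 1 + w by lra.
have P_gt0 : 0 < P.
  rewrite /P; have := exprn_ge0 3 (normr_ge0 w); have := sqr_ge0 w; lra.
have s_gt0 : 0 < Num.sqrt (1 + w) by rewrite sqrtr_gt0.
rewrite -[X in X <= _]mul1r ler_pdivrMr // -ler_sqr ?nnegrE ?ler01 //; last first.
  by rewrite mulr_ge0 // ltW.
rewrite expr1n exprMn (sqr_sqrtr (ltW w1_gt0)) -subr_ge0.
have pow_le (v : R) : 0 <= v <= 2^-1 -> [/\ 0 <= v ^+ 2, v ^+ 2 <= 4^-1, 0 <= v ^+ 3,
    0 <= v ^+ 4 & v ^+ 4 <= 4^-1].
  case/andP=> v_ge0 v_le; split; rewrite ?exprn_ge0 //.
    apply: le_trans (_ : 2^-1 ^+ 2 <= _); last by lra.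
    by rewrite lerXn2r ?nnegrE ?invr_ge0.
  apply: le_trans (_ : 2^-1 ^+ 4 <= _); last by lra.
  by rewrite lerXn2r ?nnegrE ?invr_ge0.
have [w_le0|w_gt0] := lerP w 0.
- have /pow_le[] : 0 <= - w <= 2^-1 by lra.
  rewrite /P ler0_norm //.
  (* The Taylor coefficients cancel all orders below three, and the cofactor is positive by the
     crude bounds of [pow_le]. *)
  rewrite (_ : _ - 1 = (- w) ^+ 3 * (11/8 - 79/64 * (- w) - 25/64 * (- w) ^+ 2
    + 1/4 * (- w) ^+ 3 - (- w) ^+ 4)); last by field.
  move=> *; apply: mulr_ge0 => //; lra.
- have /pow_le[] : 0 <= w <= 2^-1 by lra.
  rewrite /P gtr0_norm //.
  rewrite (_ : _ - 1 = w ^+ 3 * (21/8 + 49/64 * w - 7/64 * w ^+ 2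
    + 7/4 * w ^+ 3 + w ^+ 4)); last by field.
  move=> *; apply: mulr_ge0 => //; lra.
Qed.

Lemma ge0_of_cubic_perturbation (R : realFieldType) (K E e : R) : 0 < e ->
  (forall t, 0 < t < e -> 0 <= K * t ^+ 2 + E * t ^+ 3) -> 0 <= K.
Proof.
move=> e_gt0 H; rewrite leNgt; apply/negP => K_lt0.
(* The second bound forces [E * t < - K / 2], hence [K + E * t < 0]. *)
pose t := Num.min (e / 2) (- K / (2 * (`|E| + 1))).
have E1_gt0 : 0 < `|E| + 1 by rewrite ltr_wpDl.
have t_gt0 : 0 < t.
  by rewrite lt_min !divr_gt0 ?mulr_gt0 ?oppr_gt0 //.
have t_lt : t < e by rewrite gt_min; apply/orP; left; lra.
have : t * (2 * (`|E| + 1)) <= - K.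
  by rewrite -ler_pdivlMr ?mulr_gt0 // ge_min lexx orbT.
have := H t; rewrite t_gt0 t_lt => /(_ isT).
rewrite (_ : _ + _ = t ^+ 2 * (K + E * t)); last by ring.
rewrite pmulr_rge0 ?exprn_gt0 // => H1 H2.
have := ler_norm E; nra.
Qed.

(* Evenness of the sum over [t] and [- t] removes every odd-order term, so only
   the curvature and the cubic remainder of [invr_sqrt1D_le] survive. *)
Lemma second_order_ratio (R : rcfType) (a r u g c d e : R) :
  0 < a -> 0 < r -> 0 < g -> 0 < e ->
  (forall t, `|t| < e -> g * (a / r) <=
     g * ((a + t) / Num.sqrt (r ^+ 2 + 2 * u * t + t ^+ 2))
       + c * t + d / 2 * t ^+ 2) ->
  0 <= 3 * a / r ^+ 5 * u ^+ 2 - 2 / r ^+ 3 * u - a / r ^+ 3 + d / g.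
Proof.
move=> a_gt0 r_gt0 g_gt0 e_gt0 H.
have r_neq0 : r != 0 by rewrite gt_eqF.
have g_neq0 : g != 0 by rewrite gt_eqF.
(* The radicand is [r ^+ 2 * (1 + w t)], and [W] bounds the slope: [|w t| <= W * |t|] when
   [|t| <= 1]. *)
pose W := (2 * `|u| + 1) / r ^+ 2.
have W_gt0 : 0 < W by rewrite divr_gt0 ?exprn_gt0 // ltr_wpDl ?mulr_ge0.
pose w t := (2 * u * t + t ^+ 2) / r ^+ 2.
(* In order: the hypothesis applies, [a + t] stays positive, [t ^+ 2 <= |t|], and
   [|w t| <= 1 / 2]. *)
pose e' := Num.min (Num.min e a) (Num.min 1 (2 * W)^-1).
have e'_gt0 : 0 < e' by rewrite !lt_min e_gt0 a_gt0 ltr01 invr_gt0 mulr_gt0.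
pose p v : R := 1 - v / 2 + 3 / 8 * v ^+ 2.
have step (t s : R) : 0 < t < e' -> s = t \/ s = - t ->
    g * (a / r) <= g / r * ((a + s) * p (w s) + 2 * a * W ^+ 3 * t ^+ 3)
      + c * s + d / 2 * t ^+ 2.
  rewrite !lt_min => /andP[t0 /andP[/andP[te ta] /andP[t1 tW]]] hs.
  have hst : `|s| = t by case: hs => ->; rewrite ?normrN gtr0_norm.
  have hs2 : s ^+ 2 = t ^+ 2 by rewrite -hst real_normK ?num_real.
  have := ler_norm s; have := ler_norm (- s); rewrite normrN hst => hNs hs'.
  have w_le : `|w s| <= W * t.
    rewrite normrM (gtr0_norm (_ : 0 < (r ^+ 2)^-1)) ?invr_gt0 ?exprn_gt0 //.
    rewrite /W [leRHS]mulrAC ler_pM2r ?invr_gt0 ?exprn_gt0 //.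
    rewrite (le_trans (ler_normD _ _)) // hs2.
    rewrite (gtr0_norm (exprn_gt0 2 t0)) !normrM hst normr_nat; nra.
  have w_le2 : `|w s| <= 2^-1.
    apply: le_trans w_le _; rewrite ltW //.
    rewrite -ltr_pdivlMl // ; move: tW; rewrite invfM; lra.
  have as_gt0 : 0 < a + s by lra.
  have qE : r ^+ 2 + 2 * u * s + s ^+ 2 = r ^+ 2 * (1 + w s) by rewrite /w; field.
  have := H s; rewrite hst => /(_ te) /le_trans; apply.
  rewrite qE hs2 !lerD2r sqrtrM ?sqr_ge0 // sqrtr_sqr gtr0_norm //.
  rewrite -[g / r * _]mulrA ler_pM2l // invfM mulrCA ler_pM2l ?invr_gt0 //.
  (* Since [s < a], the remainder is multiplied by less than [2 * a]. *)
  apply: le_trans (_ : (a + s) * (p (w s) + W ^+ 3 * t ^+ 3) <= _).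
    rewrite ler_pM2l // (le_trans (invr_sqrt1D_le w_le2)) // lerD2l -exprMn.
    by rewrite lerXn2r ?nnegrE // mulr_ge0 ?ltW.
  have Wt_gt0 : 0 < W ^+ 3 * t ^+ 3 by apply: mulr_gt0; apply: exprn_gt0.
  rewrite mulrDr lerD2l -[leRHS]mulrA (ler_pM2r Wt_gt0); lra.
(* With the factor [g], this is exactly the coefficient of [t ^+ 2] in the sum over [t] and
   [- t]. *)
suff : 0 <= g * (3 * a / r ^+ 5 * u ^+ 2 - 2 / r ^+ 3 * u - a / r ^+ 3 + d / g).
  by rewrite pmulr_rge0.
(* The coefficient of [t ^+ 4] in the sum of [step] over [t] and [- t]. *)
pose E4 := g / r * (2 * (3 / 8 * (a + 4 * u) / r ^+ 4)).
apply: (@ge0_of_cubic_perturbation _ _ (`|E4| + g / r * (4 * a * W ^+ 3)) _ e'_gt0).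
move=> t ht; have /andP[t_gt0 t_lt1] : 0 < t < 1.
  by move: ht; rewrite !lt_min => /andP[-> /andP[_ /andP[-> _]]].
have := lerD (step t t ht (or_introl erefl)) (step t (- t) ht (or_intror erefl)).
rewrite -subr_ge0 => /le_trans; apply.
rewrite (_ : _ - _ = g * (3 * a / r ^+ 5 * u ^+ 2 - 2 / r ^+ 3 * u - a / r ^+ 3
    + d / g) * t ^+ 2 + (E4 * t + g / r * (4 * a * W ^+ 3)) * t ^+ 3); last first.
  by rewrite /p /w /E4; field; rewrite r_neq0 g_neq0.
(* As [t < 1], the quartic term is absorbed into the cubic one. *)
rewrite lerD2l (ler_pM2r (exprn_gt0 3 t_gt0)) lerD2r.
have := ler_norm E4; have := normr_ge0 E4; nra.
Qed.

Lemma norm2_sqr (R : realType) (n : nat) (x : 'cV[R]_n) :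
  norm2 x ^+ 2 = \sum_i x i 0 ^+ 2.
Proof. by rewrite sqr_sqrtr // sumr_ge0 // => i _; rewrite sqr_ge0. Qed.

Lemma norm2D_sqr (R : realType) (n : nat) (u v : 'cV[R]_n) (c : R) :
  norm2 (u + c *: v) ^+ 2 =
  norm2 u ^+ 2 + 2 * (\sum_i u i 0 * v i 0) * c + norm2 v ^+ 2 * c ^+ 2.
Proof.
rewrite !norm2_sqr mulr_sumr !mulr_suml -!big_split /=; apply: eq_bigr => i _.
by rewrite !mxE; ring.
Qed.

Lemma norm2_delta_mx (R : realType) (n : nat) (i : 'I_n) :
  norm2 (delta_mx i 0 : 'cV[R]_n) = 1.
Proof.
rewrite /norm2 (bigD1 i) //= big1 => [|j ji]; last by rewrite mxE (negPf ji) expr0n.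
by rewrite mxE !eqxx expr1n addr0 sqrtr1.
Qed.

Lemma norm1D_delta_mx (R : realType) (n : nat) (x : 'cV[R]_n) (i : 'I_n) (c : R) :
  norm1 (x + c *: delta_mx i 0) = norm1 x - `|x i 0| + `|x i 0 + c|.
Proof.
rewrite /norm1 !(bigD1 (P := xpredT) i) //= !mxE !eqxx mulr1.
under eq_bigr => j ji do rewrite !mxE (negPf ji) mulr0 addr0.
by ring.
Qed.

Lemma norm2_gt0 (R : realType) (n : nat) (x : 'cV[R]_n) (i : 'I_n) :
  x i 0 != 0 -> 0 < norm2 x.
Proof.
move=> xi; rewrite sqrtr_gt0 (bigD1 i) //= ltr_pwDl ?exprn_even_gt0 //.
by rewrite sumr_ge0 // => j _; rewrite sqr_ge0.
Qed.

Lemma norm1_gt0 (R : realType) (n : nat) (x : 'cV[R]_n) (i : 'I_n) :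
  x i 0 != 0 -> 0 < norm1 x.
Proof.
move=> xi; rewrite /norm1 (bigD1 i) //= ltr_pwDl ?normr_gt0 //.
by rewrite sumr_ge0.
Qed.

(** [col_submx A L *m unit_vec R Li] is [col i A], because [enum_val] undoes [enum_rank_in]. *)
Lemma gram_diagE (R : realType) (m n : nat) (A : 'M[R]_(m, n))
    (L : {set 'I_n}) (i : 'I_n) (Li : i \in L) :
  ((unit_vec R Li)^T *m ((col_submx A L)^T *m col_submx A L) *m unit_vec R Li) 0 0
  = norm2 (col i A) ^+ 2.
Proof.
rewrite !mulmxA -trmx_mul -mulmxA norm2_sqr mxE; apply: eq_bigr => k _.
by rewrite -colE !mxE enum_rankK_in // expr2.
Qed.

(** The bound on [t] prevents a sign change, so the absolute value is affine there. This treats both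
    signs of a coordinate at once. *)
Lemma normrD_sg (R : realType) (y t : R) :
  `|t| < `|y| -> `|y + t * Num.sg y| = `|y| + t.
Proof.
rewrite ltr_norml; have [y_gt0|y_lt0|->] := ltrgt0P y => /andP[t_gt t_lt].
- by rewrite gtr0_sg // mulr1 gtr0_norm //; lra.
- by rewrite ltr0_sg // ltr0_norm; lra.
- by lra.
Qed.

(** A nonzero coordinate of a point of the orthant is positive, so it can move both ways, as
    averaging over [t] and [- t] requires. *)
Lemma orthant_move (R : realType) (n : nat) (X : set 'cV[R]_n) (x : 'cV[R]_n)
    (i : 'I_n) (t : R) :
  X = @nonneg_orthant R n \/ X = [set: 'cV[R]_n] -> X x -> `|t| < `|x i 0| ->
  X (x + (t * Num.sg (x i 0)) *: delta_mx i 0).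
Proof.
case=> -> //= x_ge0 t_lt j; rewrite !mxE.
have [->|ji] := eqVneq j i; last by rewrite mulr0 addr0 x_ge0.
rewrite mulr1.
have xi_gt0 : 0 < x i 0.
  by rewrite lt_neqAle x_ge0 andbT eq_sym -normr_gt0 (le_lt_trans _ t_lt).
move: t_lt; rewrite gtr0_sg // (gtr0_norm xi_gt0) mulr1 ltr_norml => /andP[]; lra.
Qed.

(** The neighborhood of [x] is pulled back along the continuous map [t |-> x + t *: v]. *)
Lemma local_minimizer_line (R : realType) (n : nat) (D : set 'cV[R]_n)
    (f : 'cV[R]_n -> R) (x v : 'cV[R]_n) : local_minimizer D f x ->
  exists2 e : R, 0 < e & forall t, `|t| < e ->
    D (x + t *: v) -> f x <= f (x + t *: v).
Proof.
case=> _ xmin.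
have line_cvg : (fun t : R => x + t *: v) @ (0 : R) --> x + (0 : R) *: v.
  by apply: cvgD; [exact: cvg_cst|exact: scalel_continuous].
rewrite scale0r addr0 in line_cvg.
have /nbhs_norm0P[e /= e_gt0 H] := line_cvg _ xmin.
by exists e => // t; exact: H.
Qed.

Lemma second_order_necessary (R : realType) (m n : nat) (X : set 'cV[R]_n)
    (A : 'M[R]_(m, n)) (b : 'cV[R]_m) (g : R) (x : 'cV[R]_n) (i : 'I_n) :
  X = @nonneg_orthant R n \/ X = [set: 'cV[R]_n] -> 0 < g ->
  local_minimizer (X `&` [set y | y != 0]) (objective A b g) x -> x i 0 != 0 ->
  0 <= 3 * norm1 x / norm2 x ^+ 5 * `|x i 0| ^+ 2 - 2 / norm2 x ^+ 3 * `|x i 0|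
       - norm1 x / norm2 x ^+ 3 + norm2 (col i A) ^+ 2 / g.
Proof.
move=> hX g_gt0 xmin xi_neq0.
have [[Xx _] _] := xmin.
have [e e_gt0 line_min] := local_minimizer_line (Num.sg (x i 0) *: delta_mx i 0) xmin.
have sg2 : Num.sg (x i 0) ^+ 2 = 1 by rewrite sqr_sg xi_neq0.
(* The linear coefficient is the slope of the quadratic misfit along the move; the radius keeps the
   sign of the coordinate. *)
apply: (@second_order_ratio _ _ _ _ _
  (Num.sg (x i 0) * \sum_k (A *m x - b) k 0 * col i A k 0) _ (Num.min e `|x i 0|)) => //.
- exact: norm1_gt0 xi_neq0.
- exact: norm2_gt0 xi_neq0.
- by rewrite lt_min e_gt0 normr_gt0.
move=> t; rewrite lt_min => /andP[te txi].
have /= := line_min t te; rewrite scalerA; set y := x + _.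
have y_i : `|y i 0| = `|x i 0| + t by rewrite !mxE !eqxx mulr1 normrD_sg.
have y_neq0 : y != 0.
  apply: contraTneq txi => y0; move: y_i; rewrite y0 mxE normr0 ltr_norml => t_eq.
  by apply/negP => /andP[]; lra.
move=> /(_ (conj (orthant_move hX Xx txi) y_neq0)).
rewrite /objective.
have -> : norm1 y = norm1 x + t by rewrite norm1D_delta_mx normrD_sg //; ring.
have -> : norm2 y = Num.sqrt (norm2 x ^+ 2 + 2 * `|x i 0| * t + t ^+ 2).
  rewrite -[LHS]ger0_norm ?sqrtr_ge0 // -sqrtr_sqr norm2D_sqr norm2_delta_mx.
  congr Num.sqrt; rewrite (bigD1 i) //= big1 => [|j ji].
    rewrite mxE !eqxx exprMn sg2 normrEsg /=; ring.
  by rewrite mxE (negPf ji) mulr0.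
have -> : A *m y - b = A *m x - b + (t * Num.sg (x i 0)) *: col i A.
  by rewrite mulmxDr -scalemxAr -colE addrAC.
rewrite norm2D_sqr exprMn sg2.
lra.
Qed.

Theorem theorem3 (R : realType) (m n : nat) (X : set 'cV[R]_n)
    (hX : X = @nonneg_orthant R n \/ X = [set: 'cV[R]_n])
    (A : 'M[R]_(m, n)) (b : 'cV[R]_m) (hb : b != 0)
    (gamma : R) (hgamma : 0 < gamma)
    (hfeas : [set x | X x /\ A *m x = b] !=set0)
    (x : 'cV[R]_n)
    (hx : local_minimizer (X `&` [set y | y != 0]) (objective A b gamma) x) :
  let L := supp x in
  let a := norm1 x in
  let r := norm2 x in
  forall (i : 'I_n) (Li : i \in L),
  let e := unit_vec R Li in
  let AL := col_submx A L in
  let delta := (e^T *m (AL^T *m AL) *m e) 0 0 in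
  let tdelta := delta / gamma in
  let Delta :=
    4 / r ^+ 6 + 12 * a ^+ 2 / r ^+ 8 - 12 * a * tdelta / r ^+ 5 in
  let kappa1 := (2 / r ^+ 3 - Num.sqrt Delta) / (6 * a / r ^+ 5) in
  let kappa2 := (2 / r ^+ 3 + Num.sqrt Delta) / (6 * a / r ^+ 5) in
  [/\ tdelta < a / r ^+ 3 + 1 / (3 * a * r) -> 0 < Delta,
      tdelta <= a / r ^+ 3 -> kappa2 <= `|x i 0| &
      a / r ^+ 3 < tdelta -> tdelta < a / r ^+ 3 + 1 / (3 * a * r) ->
        `|x i 0| <= kappa1 \/ kappa2 <= `|x i 0| ].
Proof.
move=> L a r i Li e AL delta tdelta Delta kappa1 kappa2.
have xi_neq0 : x i 0 != 0 by have := Li; rewrite inE.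
have a_gt0 : 0 < a := norm1_gt0 xi_neq0.
have r_gt0 : 0 < r := norm2_gt0 xi_neq0.
have u_gt0 : 0 < `|x i 0| by rewrite normr_gt0.
have := second_order_necessary hX hgamma hx xi_neq0.
rewrite -/a -/r -(gram_diagE A Li) -/e -/AL -/delta -/tdelta => snd_order.
have Delta_gt0 : tdelta < a / r ^+ 3 + 1 / (3 * a * r) -> 0 < Delta.
  (* The threshold in (i) is the value of [tdelta] at which [Delta], affine in [tdelta],
     vanishes. *)
  move=> h; have -> : Delta = 12 * a / r ^+ 5 *
      (a / r ^+ 3 + 1 / (3 * a * r) - tdelta).
    by rewrite /Delta; field; rewrite !gt_eqF.
  by rewrite mulr_gt0 ?divr_gt0 ?mulr_gt0 ?exprn_gt0 ?subr_gt0.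
have lead_gt0 : 0 < 3 * a / r ^+ 5 by rewrite divr_gt0 ?mulr_gt0 ?exprn_gt0.
have kappaE : 0 < Delta -> 0 <= (`|x i 0| - kappa1) * (`|x i 0| - kappa2).
  move=> D_gt0; rewrite -(pmulr_rge0 _ lead_gt0).
  apply: le_trans snd_order _; rewrite le_eqVlt; apply/orP; left; apply/eqP.
  (* The constant term is rewritten through [Num.sqrt Delta ^+ 2], so that factoring over the roots
     becomes an identity with the square root as an atom. *)
  transitivity (3 * a / r ^+ 5 * `|x i 0| ^+ 2 - 2 / r ^+ 3 * `|x i 0| +
    (4 / r ^+ 6 - Num.sqrt Delta ^+ 2) / (12 * a / r ^+ 5)).
    by rewrite sqr_sqrtr ?ltW // /Delta; field; rewrite !gt_eqF.
  by rewrite /kappa1 /kappa2; field; rewrite !gt_eqF.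
have dichotomy : 0 < Delta -> `|x i 0| <= kappa1 \/ kappa2 <= `|x i 0|.
  move=> /kappaE H; have [|h1] := leP `|x i 0| kappa1; first by left.
  by right; rewrite -subr_ge0 -(pmulr_rge0 _ (_ : 0 < `|x i 0| - kappa1)) ?subr_gt0.
split=> // [tdelta_le|_ /Delta_gt0/dichotomy//].
have D_gt0 : 0 < Delta.
  by apply: Delta_gt0; rewrite (le_lt_trans tdelta_le) // ltrDl divr_gt0 ?mulr_gt0.
have [u_le|//] := dichotomy D_gt0.
(* Here [Delta >= (2 / r ^+ 3) ^+ 2], so the numerator of [kappa1] is nonpositive, whereas [|x i 0|]
   is positive. *)
have : kappa1 <= 0.
  rewrite pmulr_lle0 ?invr_gt0 ?divr_gt0 ?mulr_gt0 ?exprn_gt0 // subr_le0.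
  rewrite -[leLHS]ger0_norm ?divr_ge0 ?exprn_ge0 ?(ltW r_gt0) // -sqrtr_sqr ler_wsqrtr //.
  rewrite -subr_ge0; have -> : Delta - (2 / r ^+ 3) ^+ 2 =
      12 * a / r ^+ 5 * (a / r ^+ 3 - tdelta).
    by rewrite /Delta; field; rewrite !gt_eqF.
  by rewrite mulr_ge0 ?subr_ge0 // ltW // divr_gt0 ?mulr_gt0 ?exprn_gt0.
by rewrite leNgt (lt_le_trans u_gt0 u_le).
Qed.
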